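(* Let $X$ be an ordered Banach space with a closed generating cone and let $Y$ be a normed space. Then every collectively order to norm bounded set ${\cal T}\subseteq{\cal L}(X,Y)$ is norm bounded, i.e. every $T\in{\cal T}$ is bounded and $\sup_{T\in{\cal T}}\|T\|<\infty$.
   Context: All vector spaces are real and operators are linear; ${\cal L}(X,Y)$ is the space of all linear (not necessarily continuous) operators from $X$ to $Y$. An ordered Banach space is a Banach space $X$ that is also an ordered vector space with positive cone $X_+$ (with $X_+\cap(-X_+)=\{0\}$); no compatibility of norm and order is assumed beyond what is stated. The cone is generating if $X=X_+-X_+$, and closed means norm closed. Order intervals are $[a,b]=\{x: a\le x\le b\}$. A set ${\cal T}\subseteq{\cal L}(X,Y)$ is collectively order to norm bounded if, for every order interval $[a,b]\subseteq X$, the set $\bigcup_{T\in{\cal T}}T[a,b]$ is norm bounded in $Y$. *)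

(* Defs.v *)
From HB Require Import structures.
From mathcomp Require Import all_boot all_order all_algebra.
From mathcomp Require Import all_classical all_reals all_analysis.

Set Implicit Arguments.
Unset Strict Implicit.
Unset Printing Implicit Defensive.

Import Order.TTheory GRing.Theory Num.Theory.
Import numFieldNormedType.Exports.

Local Open Scope classical_set_scope.
Local Open Scope ring_scope.

(* The order is a separate relation rather than an instance of porderType:    *)
(* in the library's hierarchy the only join of an order with a norm is        *)
(* numDomainType, so normed modules cannot also inherit from porderType.      *)
HB.mixin Record isOrderedLmodule (R : numDomainType) V & GRing.Lmodule R V := {
  vle : V -> V -> Prop ;
  vle_refl : forall x, vle x x ;
  vle_anti : forall x y, vle x y -> vle y x -> x = y ;
  vle_trans : forall y x z, vle x y -> vle y z -> vle x z ;
  vle_add2r : forall z x y, vle x y -> vle (x + z) (y + z) ;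
  vle_scale2l : forall (a : R) x y, 0 <= a -> vle x y -> vle (a *: x) (a *: y)
}.

#[short(type="orderedLmodType")]
HB.structure Definition OrderedLmodule (R : numDomainType) :=
  { V of isOrderedLmodule R V & GRing.Lmodule R V }.

(* No axiom relates the norm to the order. *)
#[short(type="orderedBanachType")]
HB.structure Definition OrderedBanach (R : realType) :=
  { V of CompleteNormedModule R V & OrderedLmodule R V }.

Definition positive_cone (R : numDomainType) (X : orderedLmodType R) : set X :=
  [set x | vle 0 x].
Arguments positive_cone {R} X _.

Definition order_interval (R : numDomainType) (X : orderedLmodType R)
    (a b : X) : set X :=
  [set x | vle a x /\ vle x b].

Definition generating (V : zmodType) (C : set V) :=
  [set x - y | x in C & y in C] = setT.

Definition collectively_order_to_norm_bounded (R : realType)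
    (X : orderedLmodType R) (Y : normedModType R) (T : set {linear X -> Y}) :=
  forall a b : X, bounded_set (\bigcup_(f in T) (f @` order_interval a b)).

(* Extended-real valued: equal to +oo exactly when the linear map f is        *)
(* unbounded.                                                                 *)
Definition operator_norm (R : realType) (X Y : normedModType R)
    (f : {linear X -> Y}) : \bar R :=
  ereal_sup [set `|f x|%:E | x in [set x : X | `|x| <= 1]].

Definition norm_bounded_operators (R : realType) (X Y : normedModType R)
    (T : set {linear X -> Y}) :=
  (forall f, T f -> bounded_fun_norm f) /\
  (ereal_sup [set operator_norm f | f in T] < +oo)%E.

(* Main.v *)
(* By Baire's theorem and an open-mapping iteration, every x in the unit ball *)
(* is a difference of two positive vectors of norm at most some constant C    *)
(* (Krein-Smulian), so it suffices to bound T uniformly on the positive part  *)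
(* of the unit ball. If that fails, pick f_n in T and positive x_n in the     *)
(* unit ball with |f_n x_n| > n 2^n: the sum y of the 2^-n x_n exists and     *)
(* dominates each of its terms, so T is unbounded on [0, y].                  *)

Require Import Defs.
From mathcomp Require Import all_boot all_order all_algebra.
From mathcomp Require Import all_classical all_reals all_analysis.
From mathcomp Require Import ring lra.

Import Order.TTheory GRing.Theory Num.Theory.
Import numFieldNormedType.Exports.

Local Open Scope classical_set_scope.
Local Open Scope ring_scope.

(** The proof rests on two consequences of completeness. [unit_ball_difference_within] turns the
    purely algebraic decomposition given by a generating cone into one with norm control.
    [positive_unit_ball_bounded] bounds the operators uniformly on positive unit vectors. Linearity
    then bounds them on differences. Both use [positive_series_cvg]: a geometrically dominated
    positive series has a sum lying above each of its terms. The operators are applied only to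
    single terms of such a series, never to its sum, so merely linear maps can be handled. *)

Section OrderedLmodule.
Context {R : numDomainType} {X : orderedLmodType R}.
Implicit Types x y z : X.

Lemma vleBr_ge0 x y : vle 0 (y - x) <-> vle x y.
Proof.
split=> [/(vle_add2r x)|/(vle_add2r (- x))]; last by rewrite subrr.
by rewrite add0r subrK.
Qed.

Lemma positive_coneD x y :
  positive_cone X x -> positive_cone X y -> positive_cone X (x + y).
Proof.
move=> x0 y0; apply: (vle_trans y) => //.
by rewrite -[X in vle X _]add0r; exact: vle_add2r.
Qed.

Lemma positive_coneZ (a : R) x :
  0 <= a -> positive_cone X x -> positive_cone X (a *: x).
Proof.
by move=> a0 x0; rewrite /positive_cone/= -(scaler0 _ a); exact: vle_scale2l.
Qed.

Lemma positive_cone_sum (I : Type) (r : seq I) (P : pred I) (F : I -> X) :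
  (forall i, P i -> positive_cone X (F i)) ->
  positive_cone X (\sum_(i <- r | P i) F i).
Proof. by apply: big_ind; [exact: vle_refl|exact: positive_coneD]. Qed.

End OrderedLmodule.

Section OrderedBanach.
Context {R : realType} {X : orderedBanachType R}.
Implicit Types (x y z v : X) (r s C : R).

(** For [0 <= r] this is r times B - B, with B the positive part of the closed unit ball: a convex
    symmetric set. *)
Definition difference_within r : set X :=
  [set x | exists y z, [/\ positive_cone X y, positive_cone X z,
     `|y| <= r, `|z| <= r & x = y - z]].

Lemma difference_within_le r s x :
  r <= s -> difference_within r x -> difference_within s x.
Proof.
move=> rs [y [z [y0 z0 yr zr ->]]].
by exists y, z; split=> //; exact: le_trans rs.
Qed.

Lemma difference_withinB r s x v : difference_within r x ->
  difference_within s v -> difference_within (r + s) (x - v).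
Proof.
move=> [y [z [y0 z0 yr zr ->]]] [y' [z' [y0' z0' yr' zr' ->]]].
exists (y + z'), (z + y'); split; [exact: positive_coneD|exact: positive_coneD|..].
- by rewrite (le_trans (ler_normD _ _))// lerD.
- by rewrite (le_trans (ler_normD _ _))// lerD.
- by rewrite !opprD opprK addrACA [- z + _]addrC addrACA [- y' + _]addrC.
Qed.

Lemma difference_withinZ r (a : R) x : 0 <= a -> difference_within r x ->
  difference_within (a * r) (a *: x).
Proof.
move=> a0 [y [z [y0 z0 yr zr ->]]]; exists (a *: y), (a *: z).
split; [exact: positive_coneZ|exact: positive_coneZ|..].
- by rewrite normrZ ger0_norm// ler_wpM2l.
- by rewrite normrZ ger0_norm// ler_wpM2l.
- by rewrite scalerBr.
Qed.

(** Absolute convergence yields the sum. Once m > n, the m-th partial sum minus [u n] is a sum of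
    positive terms, and closedness of the cone passes this to the limit. *)
Lemma positive_series_cvg (u : nat -> X) C : closed (positive_cone X) ->
  (forall n, positive_cone X (u n)) -> (forall n, `|u n| <= C * 2^-1 ^+ n) ->
  exists y, [/\ series u @ \oo --> y, `|y| <= 2 * C & forall n, vle (u n) y].
Proof.
move=> clX u0 uC.
have C0 : 0 <= C by have := uC 0; rewrite expr0 mulr1; exact: le_trans.
have half1 : `|2^-1 : R| < 1 by rewrite gtr0_norm ?invr_gt0// invf_lt1 ?ltr1n.
have cg := @cvg_geometric_series R C _ half1.
have cn : cvgn [normed series u].
  apply: (@series_le_cvg R _ (geometric C 2^-1) _ _ uC (cvgP _ cg)) => n.
    exact: normr_ge0.
  exact: le_trans (uC n).
have cu := normed_cvg cn.
exists (limn (series u)); split => //.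
  apply: (le_trans (lim_series_norm cn)).
  apply: (@le_trans _ _ (limn (series (geometric C 2^-1)))).
    by apply: lim_series_le => //; exact: cvgP cg.
  rewrite (cvg_lim _ cg)//; suff -> : C / (1 - 2^-1) = 2 * C by [].
  by field.
move=> n; apply/vleBr_ge0.
apply: (@closed_cvg _ _ \oo _ (fun m => series u m - u n) _ clX).
  near=> m; rewrite /series/= big_mkord.
  have nm : (n < m)%N by near: m; exact: nbhs_infty_gt.
  rewrite (bigD1 (Ordinal nm))//= addrC addrK.
  exact: positive_cone_sum.
by apply: cvgB => //; exact: cvg_cst.
Unshelve. all: by end_near. Qed.

(* The sets [difference_within n] cover X, so by Baire the closure of one of  *)
(* them contains a ball; symmetry and convexity move the ball to the origin.  *)
Lemma approx_difference : generating (positive_cone X) ->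
  exists2 C, 0 < C & forall x e, 0 < e ->
    exists2 v, difference_within (C * `|x|) v & `|x - v| < e.
Proof.
move=> genX.
pose F n := ~` closure (difference_within n%:R).
(* Otherwise Baire gives a point outside every closure, yet a generating cone writes it as y - z,
   which lies in [difference_within] N for any N above [|y| + |z|]. *)
have [n Fn] : exists n, ~ dense (F n).
  apply/existsNP => dF.
  have [|||a [_ Fa]] := @Baire R X F _ setT.
  - by move=> i; split; [rewrite openC; exact: closed_closure|exact: dF].
  - by exists 0.
  - exact: openT.
  have [y y0 [z z0 yza]] :
      [set x - y | x in positive_cone X & y in positive_cone X] a.
    by rewrite genX.
  have := Fa (Num.truncn (`|y| + `|z|)).+1 I; apply; apply: subset_closure.
  have yzN := ltW (truncnS_gt (`|y| + `|z|)).
  exists y, z; split => //; apply: le_trans yzN.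
    by rewrite lerDl.
  by rewrite lerDr.
have [U [[x0 [Uo Ux0]] UF]] := denseNE Fn.
have Ucl x : U x -> closure (difference_within n%:R) x.
  by move=> Ux; apply: contrapT => nx; suff : set0 x by []; rewrite -UF.
have /nbhs_normP [e /= e0 eU] : nbhs x0 U by exact: open_nbhs_nbhs.
(* Approximate both x0 + x and x0 - x; half the difference of the approximants is close to x, and
   the centre cancels. *)
have nearO x d : `|x| < e -> 0 < d ->
    exists2 v, difference_within n%:R v & `|x - v| < d.
  move=> xe d0.
  have app y : `|y| < e ->
      exists2 v, difference_within n%:R v & `|x0 + y - v| < d.
    move=> ye; have /Ucl/(_ (ball (x0 + y) d)) : U (x0 + y).
      by apply: eU; rewrite /ball_/= opprD addNKr normrN.
    by move=> /(_ (nbhsx_ballx _ _ d0))[v [Dv]]; rewrite -ball_normE; exists v.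
  have [v Dv vd] := app _ xe.
  have [|w Dw wd] := app (- x); first by rewrite normrN.
  exists (2^-1 *: (v - w)).
    have -> : n%:R = 2^-1 * (n%:R + n%:R) :> R by field.
    by apply: difference_withinZ; [rewrite invr_ge0|exact: difference_withinB].
  have -> : x - 2^-1 *: (v - w) = 2^-1 *: ((x0 + x - v) - (x0 - x - w)).
    have -> : x0 + x - v - (x0 - x - w) = x *+ 2 - (v - w).
      rewrite [- (x0 - x - w)]opprD addrACA -opprD opprB [x0 + x]addrC.
      by rewrite addrACA subrr addr0 mulr2n.
    by rewrite [RHS]scalerBr -[x *+ 2]scaler_nat scalerA mulVf// scale1r.
  rewrite normrZ gtr0_norm ?invr_gt0//.
  have := ler_normB (x0 + x - v) (x0 - x - w); lra.
(* The factor 2 / e rescales x to norm e / 2, inside the ball; [n.+1] keeps the constant positive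
   even if n = 0. *)
exists (n.+1%:R * (2 / e)); first by rewrite mulr_gt0// divr_gt0.
move=> x d d0; have [->|xn0] := eqVneq x 0.
  exists 0; last by rewrite subrr normr0.
  rewrite normr0 mulr0; exists 0, 0.
  by split; rewrite ?normr0 ?subr0//; exact: vle_refl.
have x_gt0 : 0 < `|x| by rewrite normr_gt0.
pose a := `|x| * (2 / e).
have a0 : 0 < a by rewrite mulr_gt0// divr_gt0.
have [||v Dv vd] := nearO (a^-1 *: x) (a^-1 * d).
- rewrite normrZ gtr0_norm ?invr_gt0// /a invfM mulrAC mulVf ?gt_eqF//.
  rewrite mul1r invf_div.
  lra.
- by rewrite mulr_gt0// invr_gt0.
exists (a *: v).
  apply: (@difference_within_le (a * n%:R)).
    have -> : n.+1%:R * (2 / e) * `|x| = a * n.+1%:R by rewrite /a; ring.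
    by rewrite ler_pM2l// ler_nat.
  by apply: difference_withinZ => //; exact: ltW.
have -> : x - a *: v = a *: (a^-1 *: x - v).
  by rewrite scalerBr scalerA divff ?gt_eqF// scale1r.
by rewrite normrZ gtr0_norm// -ltr_pdivlMl.
Qed.

(** Iterated approximation: [w n] is the remainder after n steps, of norm at most 2^-n, so the
    positive parts split off at each step form two geometrically dominated series. *)
Lemma unit_ball_difference_within :
  closed (positive_cone X) -> generating (positive_cone X) ->
  exists C, forall x, `|x| <= 1 -> difference_within C x.
Proof.
move=> clX genX; have [C C0 app] := approx_difference genX.
have /choice[g gP] (nx : nat * X) : exists yz : X * X,
    [/\ positive_cone X yz.1, positive_cone X yz.2,
     `|yz.1| <= C * `|nx.2|, `|yz.2| <= C * `|nx.2| &
     `|nx.2 - (yz.1 - yz.2)| <= 2^-1 ^+ nx.1.+1].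
  have [|v [y [z [y0 z0 yC zC ->]]] vd] := app nx.2 (2^-1 ^+ nx.1.+1).
    by rewrite exprn_gt0// invr_gt0.
  by exists (y, z); split => //; exact: ltW.
exists (2 * C) => x x1.
pose w := fix w n := if n is m.+1 then
  w m - ((g (m, w m)).1 - (g (m, w m)).2) else x.
have wP n : `|w n| <= 2^-1 ^+ n.
  by case: n => [//|n] /=; case: (gP (n, w n)).
pose u n := (g (n, w n)).1; pose v n := (g (n, w n)).2.
have [y [uy yC y0]] : exists y,
    [/\ series u @ \oo --> y, `|y| <= 2 * C & forall n, vle (u n) y].
  apply: positive_series_cvg => // n; first by case: (gP (n, w n)).
  have [_ _ /le_trans + _ _] := gP (n, w n); apply.
  by rewrite ler_pM2l// wP.
have [z [vz zC z0]] : exists z,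
    [/\ series v @ \oo --> z, `|z| <= 2 * C & forall n, vle (v n) z].
  apply: positive_series_cvg => // n; first by case: (gP (n, w n)).
  have [_ _ _ /le_trans + _] := gP (n, w n); apply.
  by rewrite ler_pM2l// wP.
exists y, z; split => //.
(* The sum is positive because it dominates its first term, which is positive. *)
- by apply: vle_trans (y0 0); case: (gP (0, w 0)).
- by apply: vle_trans (z0 0); case: (gP (0, w 0)).
have wE n : w n = x - (series u n - series v n).
  elim: n => [|n IH]; first by rewrite /series/= !big_geq// !subr0.
  have -> : w n.+1 = w n - (u n - v n) by [].
  rewrite IH /series/= !big_nat_recr//=.
  by rewrite -addrA -opprD addrACA -opprD.
have w0 : w @ \oo --> (0 : X).
  apply/norm_cvg0P; apply: (squeeze_cvgr _ (cvg_cst 0)); last first.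
    by apply: (@cvg_expr R 2^-1); rewrite gtr0_norm ?invr_gt0// invf_lt1 ?ltr1n.
  by near=> m; rewrite normr_ge0 wP.
have wyz : w @ \oo --> x - (y - z).
  rewrite (_ : w = fun n => x - (series u n - series v n)); last exact/funext.
  by apply: cvgB; [exact: cvg_cst|exact: cvgB].
by apply/eqP; rewrite -subr_eq0; apply/eqP; apply: (cvg_unique _ wyz w0).
Unshelve. all: by end_near. Qed.

(** The factor 2^n in the choice of the counterexamples compensates the weight 2^-n that makes the
    series converge, so the images of its terms still have norm above n. *)
Lemma positive_unit_ball_bounded {Y : normedModType R} {T : set {linear X -> Y}} :
  closed (positive_cone X) -> collectively_order_to_norm_bounded T ->
  exists M, forall f x, T f -> positive_cone X x -> `|x| <= 1 -> `|f x| <= M.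
Proof.
move=> clX bT; apply: contrapT => unb.
have /choice[g gP] (n : nat) : exists fx : {linear X -> Y} * X,
    [/\ T fx.1, positive_cone X fx.2, `|fx.2| <= 1 & n%:R * 2 ^+ n < `|fx.1 fx.2|].
  apply: contrapT => bn; apply: unb; exists (n%:R * 2 ^+ n) => f x Tf x0 x1.
  by rewrite leNgt; apply/negP => fx; apply: bn; exists (f, x).
pose u n := 2^-1 ^+ n *: (g n).2.
have half0 n : 0 < 2^-1 ^+ n :> R by rewrite exprn_gt0// invr_gt0.
have u0 n : positive_cone X (u n).
  by apply: positive_coneZ; [exact: ltW|case: (gP n)].
have [|y [_ _ uy]] := @positive_series_cvg u 1 clX u0.
  move=> n; rewrite normrZ gtr0_norm// mulrC ler_pM2r//.
  by case: (gP n).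
have /ex_strict_bound_gt0[M _ /= bM] := bT 0 y.
pose n := (Num.truncn M).+1.
have [Tg _ _ gn] := gP n.
have : `|(g n).1 (u n)| <= M.
  apply: ltW; apply: bM; exists (g n).1 => //; exists (u n) => //.
  by split; [exact: u0|exact: uy].
apply/negP; rewrite -ltNge linearZ/= normrZ gtr0_norm//.
apply: (lt_trans (truncnS_gt M)).
by rewrite exprVn mulrC ltr_pdivlMr// exprn_gt0.
Qed.

End OrderedBanach.

Theorem theorem2p8 (R : realType) (X : orderedBanachType R)
    (Y : normedModType R) (T : set {linear X -> Y}) :
  closed (positive_cone X) ->
  generating (positive_cone X) ->
  collectively_order_to_norm_bounded T ->
  norm_bounded_operators T.
Proof.
move=> clX genX bT.
have [C DC] := unit_ball_difference_within clX genX.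
have [M MP] := positive_unit_ball_bounded clX bT.
have posM f x : T f -> positive_cone X x -> `|f x| <= M * `|x|.
  move=> Tf x0; have [->|xn0] := eqVneq x 0.
    by rewrite linear0 !normr0 mulr0.
  have nx : 0 < `|x| by rewrite normr_gt0.
  rewrite -ler_pdivrMr// mulrC -[X in X * _]gtr0_norm ?invr_gt0//.
  rewrite -normrZ -linearZ/=.
  apply: MP => //; first by apply: positive_coneZ => //; rewrite invr_ge0.
  by rewrite normrZ gtr0_norm ?invr_gt0// mulVf ?gt_eqF.
have bound f x : T f -> `|x| <= 1 -> `|f x| <= 2 * (`|M| * C).
  move=> Tf /DC[y [z [y0 z0 yC zC ->]]]; rewrite linearB/=.
  (* The sign of M is unknown, so [|M|] is used to keep the bound monotone in [|v|]. *)
  have leM v : positive_cone X v -> `|v| <= C -> `|f v| <= `|M| * C.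
    move=> v0 vC; apply: (le_trans (posM f v Tf v0)).
    apply: (@le_trans _ _ (`|M| * `|v|)).
      by rewrite ler_wpM2r// ler_norm.
    by rewrite ler_wpM2l.
  by rewrite (le_trans (ler_normB _ _))// mulr_natl mulr2n lerD// leM.
split=> [f Tf r|].
  (* Rescaling by [|r| + 1], which is positive for every r, moves x into the unit ball. *)
  exists ((`|r| + 1) * (2 * (`|M| * C))) => x xr.
  have r1 : 0 < `|r| + 1 by rewrite ltr_pwDr.
  rewrite -ler_pdivrMl// -[X in X * _]gtr0_norm ?invr_gt0//.
  rewrite -normrZ -linearZ/=.
  apply: bound => //; rewrite normrZ gtr0_norm ?invr_gt0// ler_pdivrMl// mulr1.
  by have := ler_norm r; lra.
apply: (@le_lt_trans _ _ (2 * (`|M| * C))%:E); last exact: ltry.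
apply: ge_ereal_sup => _ [f Tf <-]; apply: ge_ereal_sup => _ [x x1 <-].
by rewrite lee_fin bound.
Qed.
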